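(* Let $H\in(0,1)$, let $(a,b)\in\mathbb{R}^2\setminus\{(0,0)\}$, and let $Z^H=(Z_t^H(a,b))_{t\ge 0}$ be the generalized fractional Brownian motion with parameters $a,b,H$. (1) $Z^H$ admits a version whose sample paths are almost surely H\''older continuous, on every compact interval of $[0,\infty)$, of every order strictly less than $H$. (2) For this version and for every $t_0\ge 0$, with probability one, $$\lim_{\epsilon\to0^+}\ \sup_{t\in[t_0-\epsilon,\,t_0+\epsilon]\cap[0,\infty),\ t\ne t_0}\left|\frac{Z^H_t-Z^H_{t_0}}{t-t_0}\right|=+\infty .$$
   Context: For $H\in(0,1)$, a two-sided fractional Brownian motion with Hurst parameter $H$ is a centered Gaussian process $B^H=(B_t^H)_{t\in\mathbb{R}}$ on a probability space $(\Omega,F,\mathbb{P})$ with covariance $\operatorname{Cov}(B_t^H,B_s^H)=\frac12\bigl(|s|^{2H}+|t|^{2H}-|t-s|^{2H}\bigr)$ for $s,t\in\mathbb{R}$. For real $a,b$ with $(a,b)\ne(0,0)$, the generalized fractional Brownian motion (gfBm) with parameters $a,b,H$ is the process $Z^H=(Z_t^H)_{t\ge0}$ defined by $Z_t^H=Z_t^H(a,b)=aB_t^H+bB_{-t}^H$ for $t\ge 0$. A version of $Z^H$ is a process $\tilde Z$ with $\mathbb{P}(\tilde Z_t=Z_t^H)=1$ for every $t\ge0$. In (2), the exceptional null set may depend on $t_0$. *)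

(* Defs.v *)
From mathcomp Require Import all_boot all_order all_algebra.
From mathcomp Require Import all_classical all_reals all_analysis.
Set Implicit Arguments.
Unset Strict Implicit.
Unset Printing Implicit Defensive.
Import Order.TTheory GRing.Theory Num.Theory.
Import numFieldNormedType.Exports.
Local Open Scope classical_set_scope.
Local Open Scope ring_scope.

(* A degenerate Gaussian is a point mass. The case s = 0 has to be excluded
   from the second alternative because [normal_prob m 0] is the uniform law on
   [0, 1]. The laws are compared on measurable sets only, the only sets on
   which measures are meaningful. *)
Definition gaussian_law (R : realType) (d : measure_display)
    (T : measurableType d) (P : probability T R) (X : T -> R) : Prop :=
  (exists m : R, forall A : set R, measurable A ->
     pushforward P X A = \d_m A) \/
  (exists m s : R, s != 0 /\ forall A : set R, measurable A ->
     pushforward P X A = normal_prob m s A).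

(* Joint normality of a random vector: every linear combination of its
   components is a possibly degenerate univariate Gaussian. *)
Definition gaussian_process (R : realType) (d : measure_display)
    (T : measurableType d) (P : probability T R)
    (B : R -> {RV P >-> R}) : Prop :=
  forall (n : nat) (t c : 'I_n -> R),
    gaussian_law P (fun w => \sum_(i < n) c i * B (t i) w).

Definition is_fBm (R : realType) (d : measure_display)
    (T : measurableType d) (P : probability T R) (H : R)
    (B : R -> {RV P >-> R}) : Prop :=
  [/\ gaussian_process B,
      forall t : R, ('E_P[B t] = 0)%E &
      forall t s : R, covariance P (B t) (B s) =
        (2^-1 * (`|s| `^ (2 * H) + `|t| `^ (2 * H)
                 - `|t - s| `^ (2 * H)))%:E].

(* Processes indexed by [0, +oo[ are represented by families indexed by R whose
   members at negative times are irrelevant. *)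
Definition gfBm (R : realType) (d : measure_display)
    (T : measurableType d) (P : probability T R) (a b : R)
    (B : R -> {RV P >-> R}) (t : R) (w : T) : R :=
  a * B t w + b * B (- t) w.

Definition is_version (R : realType) (d : measure_display)
    (T : measurableType d) (P : probability T R)
    (Z' : R -> {RV P >-> R}) (Z : R -> T -> R) : Prop :=
  forall t : R, 0 <= t -> P [set w | Z' t w = Z t w] = 1%E.

Definition hoelder_on (R : realType) (D : set R) (g : R) (f : R -> R) : Prop :=
  exists C : R, forall s t : R, D s -> D t ->
    `|f s - f t| <= C * `|s - t| `^ g.

(* The supremum is taken in the extended reals. *)
Definition sup_diff_quotient (R : realType) (f : R -> R) (t0 e : R) : \bar R :=
  ereal_sup [set (`|(f t - f t0) / (t - t0)|)%:E |
    t in [set t : R | [/\ t0 - e <= t <= t0 + e, 0 <= t & t != t0]]].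

(* Main.v *)
Require Import Defs.
From HB Require Import structures.
From mathcomp Require Import all_boot all_order all_algebra.
From mathcomp Require Import all_classical all_reals all_analysis.
From mathcomp Require Import measurable_realfun zify ring lra.
Import Order.TTheory GRing.Theory Num.Theory.
Import numFieldNormedType.Exports.
Local Open Scope classical_set_scope.
Local Open Scope ring_scope.

(* For the regularity it is enough to treat B itself, as Z_t = a B_t + b B_{-t}.
   The increment of B over a dyadic interval of length 2^-n is Gaussian with
   standard deviation 2^(-nH), so by Borel-Cantelli almost surely all but finitely
   many increments over level-n dyadic intervals in [-2^n, 2^n] are at most
   16 (n + 1) 2^(-nH). The version is the limit of B along dyadic approximations
   of t; two points at distance about 2^-n have equal or adjacent level-n
   approximations, and the remaining errors sum up geometrically.
   For the irregularity at t0, the variance of Z_{t0+h} - Z_{t0} is at least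
   c h^(2H) for small h, so, the Gaussian density being bounded, the probability
   that this increment is at most M h tends to 0 with h. Hence almost surely no M
   bounds the difference quotients along t0 + 1/n. *)

(** * Gaussian laws *)

Lemma measurable_norm_ge (R : realType) (r : R) : measurable [set x : R | r <= `|x|].
Proof.
have -> : [set x : R | r <= `|x|] = (@Num.norm R R) @^-1` `[r, +oo[.
  by apply/seteqP; split=> x /=; rewrite in_itv/= andbT.
rewrite -[X in measurable X]setTI.
exact: (@normr_measurable R setT measurableT _ (measurable_itv _)).
Qed.

Lemma measurable_norm_le (R : realType) (r : R) : measurable [set x : R | `|x| <= r].
Proof.
have -> : [set x : R | `|x| <= r] = (@Num.norm R R) @^-1` `]-oo, r].
  by apply/seteqP; split=> x /=; rewrite in_itv.
rewrite -[X in measurable X]setTI.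
exact: (@normr_measurable R setT measurableT _ (measurable_itv _)).
Qed.

Lemma ge0_integral_normal_prob (R : realType) (m s : R) (f : R -> R) :
  measurable_fun [set: R] f -> (forall x, 0 <= f x) ->
  (\int[normal_prob m s]_x (f x)%:E =
   \int[lebesgue_measure]_x (f x * normal_pdf m s x)%:E)%E.
Proof.
move=> mf f0; have dom := normal_prob_dominates m s.
have mEf : measurable_fun [set: R] (EFin \o f) by exact/measurable_EFinP.
have Ef0 x : (0 <= (EFin \o f) x)%E by rewrite lee_fin.
rewrite -(@Radon_Nikodym_SigmaFinite.change_of_variables _ _ _ _ _ dom _ _ Ef0)//.
have intf := Radon_Nikodym_SigmaFinite.f_integrable dom.
under [in RHS]eq_integral do rewrite EFinM.
apply: ae_eq_integral => //.
- by apply: emeasurable_funM => //; exact: measurable_int intf.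
- by apply: emeasurable_funM => //; apply/measurable_EFinP; exact: measurable_normal_pdf.
- apply: ae_eqe_mul2l; apply: integral_ae_eq => //.
    by apply/measurable_EFinP; exact: measurable_normal_pdf.
  by move=> E _ mE; rewrite -Radon_Nikodym_SigmaFinite.f_integral.
Qed.

(* Completing the square: [expR (t * x)] times the density of N(m, s^2) is a
   multiple of the density of N(m + s^2 t, s^2). *)
Lemma mgf_normal_prob (R : realType) (m s t : R) : s != 0 ->
  (\int[normal_prob m s]_x (expR (t * x))%:E =
   (expR (m * t + s ^+ 2 * t ^+ 2 / 2))%:E)%E.
Proof.
move=> s0; rewrite ge0_integral_normal_prob; last 2 first.
- by apply: measurableT_comp => //; exact: mulrl_measurable.
- by move=> x; rewrite expR_ge0.
under eq_integral => x _.
  rewrite (_ : _%:E = ((expR (m * t + s ^+ 2 * t ^+ 2 / 2))%:E *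
     (normal_pdf (m + s ^+ 2 * t) s x)%:E)%E); first over.
  rewrite -!EFinM !normal_pdfE// /normal_fun mulrCA [in RHS]mulrCA -!expRD.
  congr (_ * expR _)%:E.
  by field.
rewrite ge0_integralZl ?integral_normal_pdf ?mule1//.
- by apply/measurable_EFinP; exact: measurable_normal_pdf.
- by move=> x _; rewrite lee_fin normal_pdf_ge0.
Qed.

Lemma normal_prob_ball (R : realType) (m s r : R) : s != 0 -> 0 <= r ->
  (normal_prob m s [set x | `|x| <= r]%R <= (2 * r * normal_peak s)%:E)%E.
Proof.
move=> s0 r0.
have -> : [set x | `|x| <= r]%R = `[- r, r]%classic.
  by apply/seteqP; split=> x /=; rewrite in_itv/= ler_norml.
apply: (@le_trans _ _ (\int[lebesgue_measure]_(x in `[(- r)%R, r]) (normal_peak s)%:E)%E).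
  apply: ge0_le_integral => //=.
  - by move=> x _; rewrite lee_fin normal_pdf_ge0.
  - by apply/measurable_EFinP/measurable_funTS; exact: measurable_normal_pdf.
  - by move=> x _; rewrite lee_fin normal_pdf_ub.
rewrite integral_cst//= lebesgue_measure_itv /= lte_fin.
case: ifPn => _.
  by rewrite -EFinB -EFinM lee_fin; lra.
by rewrite mule0 lee_fin !mulr_ge0// normal_peak_ge0.
Qed.

(* On [{|x| >= l}], the density of N(0, s^2) is at most sqrt 2 expR (- l^2 / (4 s^2))
   times the density of N(0, 2 s^2). *)
Lemma normal_prob_tail (R : realType) (s l : R) : s != 0 -> 0 <= l ->
  (normal_prob 0 s [set x | l <= `|x|]%R <=
     (2 * expR (- (l ^+ 2 / (4 * s ^+ 2))))%:E)%E.
Proof.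
move=> s0 l0.
have mA := measurable_norm_ge R l.
have r20 : 0 < Num.sqrt 2 :> R by rewrite sqrtr_gt0.
have r2s : Num.sqrt 2 * s != 0 by rewrite mulf_neq0// gt_eqF.
set c := 2 * expR _.
have c0 : 0 <= c by rewrite mulr_ge0// expR_ge0.
apply: (@le_trans _ _ (\int[lebesgue_measure]_(x in [set x | l <= `|x|]%R)
   (c * normal_pdf 0 (Num.sqrt 2 * s) x)%:E)%E).
  apply: ge0_le_integral => //=.
  - by move=> x _; rewrite lee_fin normal_pdf_ge0.
  - by apply/measurable_EFinP/measurable_funTS; exact: measurable_normal_pdf.
  - apply/measurable_EFinP/measurable_funTS; apply: measurable_funM => //.
    exact: measurable_normal_pdf.
  move=> x lx; rewrite lee_fin !normal_pdfE//.
  have -> : normal_peak s = Num.sqrt 2 * normal_peak (Num.sqrt 2 * s).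
    rewrite /normal_peak exprMn sqr_sqrtr//.
    rewrite (_ : 2 * s ^+ 2 * pi *+ 2 = 2 * (s ^+ 2 * pi *+ 2)); last by ring.
    by rewrite sqrtrM// invfM mulVKf// gt_eqF.
  rewrite -mulrA [in leRHS]mulrCA [in leLHS]mulrCA ler_wpM2l ?normal_peak_ge0//.
  rewrite /c -mulrA ler_pM ?normal_fun_ge0 ?sqrtr_ge0//.
    by rewrite -(@ler_pXn2r _ 2)// ?nnegrE ?sqrtr_ge0// sqr_sqrtr//; lra.
  rewrite /normal_fun -expRD ler_expR subr0 exprMn sqr_sqrtr//.
  have s20 : 0 < s ^+ 2 by rewrite exprn_even_gt0.
  have : l ^+ 2 <= x ^+ 2 by rewrite -[x ^+ 2]real_normK ?num_real// lerXn2r ?nnegrE.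
  set y := x ^+ 2; set k := s ^+ 2 => ly.
  rewrite -subr_ge0.
  rewrite (_ : _ - _ = (y - l ^+ 2) / (4 * k)); last by field; rewrite gt_eqF.
  by rewrite divr_ge0 ?subr_ge0// mulr_ge0// ltW.
under eq_integral do rewrite EFinM.
rewrite ge0_integralZl//=; last 2 first.
- by apply/measurable_EFinP/measurable_funTS; exact: measurable_normal_pdf.
- by move=> x _; rewrite lee_fin normal_pdf_ge0.
rewrite -[leRHS]mule1 lee_wpmul2l ?lee_fin//.
exact: (@probability_le1 _ _ _ (normal_prob 0 (Num.sqrt 2 * s))).
Qed.

Lemma le_sqr_expR (R : realType) (y : R) : y ^+ 2 <= 4 * (expR y + expR (- y)).
Proof.
wlog y0 : y / 0 <= y => [hw|].
  have [/hw//|/ltW y0] := leP 0 y.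
  by have := hw (- y); rewrite oppr_ge0 sqrrN opprK addrC => /(_ y0).
have h : y / 2 <= expR (y / 2).
  by rewrite (le_trans _ (expR_ge1Dx _))// lerDr.
have -> : expR y = expR (y / 2) ^+ 2 by rewrite -expRM_natr divfK.
have : (y / 2) ^+ 2 <= expR (y / 2) ^+ 2.
  by rewrite lerXn2r ?nnegrE ?expR_ge0// divr_ge0.
have := expR_ge0 (- y); nra.
Qed.

Lemma measurable_ge_norm d (T : measurableType d) (R : realType)
    (X : {mfun T >-> R}) (r : R) : measurable [set w | r <= `|X w|].
Proof.
have := @measurable_funPT _ _ _ _ X measurableT _ (measurable_norm_ge R r).
by rewrite setTI.
Qed.

Lemma measurable_le_norm d (T : measurableType d) (R : realType)
    (X : {mfun T >-> R}) (r : R) : measurable [set w | `|X w| <= r].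
Proof.
have := @measurable_funPT _ _ _ _ X measurableT _ (measurable_norm_le R r).
by rewrite setTI.
Qed.

Section centered_gaussian.
Context {R : realType} {d : measure_display} {T : measurableType d}.
Context (P : probability T R) (X : {RV P >-> R}).
Hypothesis X2 : (X : T -> R) \in Lfun P 2%:E.
Hypothesis EX0 : ('E_P[X] = 0)%E.

Let X1 : (X : T -> R) \in Lfun P 1.
Proof. exact: (Lfun_subset12 (fin_num_measure P _ measurableT)) X2. Qed.

Lemma dirac_law_centered (m : R) :
  (forall A : set R, measurable A -> pushforward P X A = \d_m A) -> m = 0.
Proof.
move=> law.
have intX : P.-integrable setT (EFin \o X) by exact/Lfun1_integrable.
have := @integral_distribution _ _ _ _ _ P X EFin _ intX.
rewrite (@eq_measure_integral _ _ _ _ (dirac m)); last by move=> A mA _; exact: law.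
rewrite integral_dirac//= diracT mul1e.
move: EX0; rewrite unlock => -> h.
by apply: EFin_inj; exact: h.
Qed.

Section normal.
Variables (m s : R).
Hypothesis s0 : s != 0.
Hypothesis law : forall A : set R, measurable A ->
  pushforward P X A = normal_prob m s A.

(* [normal_prob] is a measure on [measurableTypeR R], which carries another
   display than [R]; hence the repackaging of [X]. *)
Lemma ge0_expectation_normal_law (f : R -> R) : measurable_fun [set: R] f ->
  (forall x, 0 <= f x) ->
  ('E_P[f \o X] = \int[normal_prob m s]_x (f x)%:E)%E.
Proof.
move=> mf f0; rewrite unlock.
have mX : measurable_fun setT (X : T -> measurableTypeR R).
  exact: (@measurable_funPT _ _ T R X).
pose mixX := isMeasurableFun.Build _ _ _ _ _ mX.
pose X' : {mfun T >-> measurableTypeR R} := HB.pack (X : T -> measurableTypeR R) mixX.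
rewrite (@eq_measure_integral _ _ _ _ (distribution P X')); last first.
  by move=> A mA _; exact/esym/law.
by rewrite ge0_integral_distribution//; exact/measurable_EFinP.
Qed.

Lemma mgf_normal_law (t : R) :
  ('E_P[(fun x => expR (t * x)) \o X] = (expR (m * t + s ^+ 2 * t ^+ 2 / 2))%:E)%E.
Proof.
rewrite ge0_expectation_normal_law ?mgf_normal_prob//.
by apply: measurableT_comp => //; exact: mulrl_measurable.
Qed.

(* By [1 + x <= expR x] the moment generating function of a centered variable is
   at least 1, which is false at [t = - m / s ^+ 2] unless [m = 0]. *)
Lemma normal_law_centered : m = 0.
Proof.
have mgf1 t : 1 <= expR (m * t + s ^+ 2 * t ^+ 2 / 2).
  rewrite -lee_fin -mgf_normal_law.
  have mexp : measurable_fun [set: T] ((fun x => expR (t * x)) \o X).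
    apply: measurableT_comp => //.
    by apply: measurableT_comp => //; exact: mulrl_measurable.
  have tX1 : (t \o* X : T -> R) \in Lfun P 1 by rewrite Lfun_scale.
  have -> : (1%:E = 'E_P[cst 1%R \+ t \o* X])%E.
    rewrite expectationD//; last exact: Lfun_cst.
    by rewrite expectation_cst expectationZl// EX0 mule0 adde0.
  rewrite unlock; apply: le_integral => //.
  - by apply/Lfun1_integrable; rewrite rpredD//; exact: Lfun_cst.
  - apply/integrableP; split; first exact/measurable_EFinP.
    under eq_integral do rewrite /= ger0_norm ?expR_ge0//.
    by have := mgf_normal_law t; rewrite unlock => ->; rewrite ltry.
  - by move=> w _; rewrite lee_fin /= mulrC expR_ge1Dx.
have s20 : 0 < s ^+ 2 by rewrite exprn_even_gt0.
have := mgf1 (- m / s ^+ 2); rewrite -[X in X <= _]expR0 ler_expR.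
rewrite (_ : _ + _ = - (m ^+ 2 / (2 * s ^+ 2))); last by field.
rewrite oppr_ge0 pmulr_lle0; last by rewrite invr_gt0 pmulr_rgt0.
move=> h.
by apply/eqP; rewrite -sqrf_eq0 eq_le h sqr_ge0.
Qed.

Lemma variance_normal_law_le : ('V_P[X] <= (16 * s ^+ 2)%:E)%E.
Proof.
rewrite varianceE// EX0 expe2 mule0 sube0.
have m0 := normal_law_centered.
have mt t : measurable_fun [set: R] (fun x => expR (t * x)).
  by apply: measurableT_comp => //; exact: mulrl_measurable.
have -> : (X : T -> R) ^+ 2 = (fun x => x ^+ 2) \o X by apply/funext.
pose f x := 4 * s ^+ 2 * (expR (s^-1 * x) + expR (- s^-1 * x)).
have le w : ((fun x => x ^+ 2) \o X) w <= (f \o X) w.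
  have := le_sqr_expR _ (s^-1 * X w); rewrite /= /f mulNr exprMn exprVn.
  have s20 : 0 < s ^+ 2 by rewrite exprn_even_gt0.
  by rewrite mulrC ler_pdivrMr// => /le_trans; apply; rewrite mulrAC.
have mf : measurable_fun [set: R] f.
  by apply: measurable_funM => //; exact: measurable_funD.
have mg : measurable_fun [set: R] (fun x => expR (s^-1 * x) + expR (- s^-1 * x)).
  exact: measurable_funD.
have f0 x : 0 <= f x.
  by rewrite mulr_ge0 ?addr_ge0 ?expR_ge0// mulr_ge0// sqr_ge0.
apply: (@le_trans _ _ ('E_P[f \o X])%E).
  apply: expectation_le => //.
  - by apply: measurableT_comp => //; exact: exprn_measurable.
  - exact: measurableT_comp.
  - by move=> w; exact: sqr_ge0.
  - by move=> w; exact: f0.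
  - exact/aeW.
rewrite ge0_expectation_normal_law//.
under eq_integral do rewrite EFinM.
rewrite ge0_integralZl//=; last 2 first.
- by apply/measurable_EFinP; exact: mg.
- by rewrite lee_fin mulr_ge0// sqr_ge0.
under eq_integral do rewrite EFinD.
rewrite ge0_integralD//=; last 2 first.
- by apply/measurable_EFinP; exact: mt.
- by apply/measurable_EFinP; exact: mt.
rewrite !mgf_normal_prob// m0 !mul0r !add0r sqrrN exprVn divff ?sqrf_eq0//.
rewrite -EFinD -EFinM lee_fin.
have e2 : expR (1 / 2) <= 2 :> R.
  have := expR_ge1Dx (- (1 / 2) : R); rewrite expRN => h.
  have := expR_gt0 (1 / 2 : R); set e := expR _ in h * => e0.
  by rewrite -[e]invrK -[leRHS]invrK lef_pV2 ?posrE ?invr_gt0//; lra.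
have := sqr_ge0 s; nra.
Qed.

Lemma normal_peak_le : normal_peak s <= (2 * `|s|)^-1.
Proof.
have s1 : 0 < `|s| by rewrite normr_gt0.
rewrite /normal_peak lef_pV2 ?posrE ?mulr_gt0//; last first.
  by rewrite sqrtr_gt0 mulrn_wgt0// mulr_gt0 ?pi_gt0// exprn_even_gt0.
rewrite -[leLHS]ger0_norm ?mulr_ge0// -sqrtr_sqr ler_sqrt; last first.
  by rewrite mulrn_wge0// mulr_ge0 ?sqr_ge0// pi_ge0.
rewrite exprMn real_normK ?num_real//.
by have := sqr_ge0 s; have := @pi_ge2 R; nra.
Qed.

Lemma ball_normal_law (r : R) : 0 <= r ->
  (P [set w | `|X w| <= r]%R <= (r / `|s|)%:E)%E.
Proof.
move=> r0.
have -> : P [set w | `|X w| <= r] = pushforward P X [set x | `|x| <= r] by [].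
rewrite law; last first.
  rewrite (_ : mkset _ = `[- r, r]%classic)//.
  by apply/seteqP; split=> x /=; rewrite in_itv/= ler_norml.
apply: (le_trans (normal_prob_ball _ _ _ _ s0 r0)).
rewrite lee_fin (_ : r / `|s| = 2 * r * (2 * `|s|)^-1).
  by rewrite ler_wpM2l ?mulr_ge0// normal_peak_le.
by field; rewrite normr_eq0.
Qed.

(* By Chebyshev's inequality the ball of radius [2 sqrt v] has probability at
   least 3/4, whereas the density is at most [1 / (2 |s|)]. *)
Lemma variance_normal_law_ge (v : R) : 0 < v -> ('V_P[X] <= v%:E)%E ->
  s ^+ 2 <= 8 * v.
Proof.
move=> v0 Vv.
have s1 : 0 < `|s| by rewrite normr_gt0.
set r := 2 * Num.sqrt v.
have r0 : 0 < r by rewrite mulr_gt0// sqrtr_gt0.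
have r2 : r ^+ 2 = 4 * v by rewrite exprMn sqr_sqrtr ?ltW//; ring.
have := chebyshev X r0; rewrite EX0/=.
under eq_set do rewrite subr0.
move=> cheb.
have {cheb} le14 : (P [set w | (r <= `|X w|)%R] <= (1 / 4)%:E)%E.
  apply: (le_trans cheb); rewrite r2.
  apply: (@le_trans _ _ (((4 * v)^-1)%:E * v%:E)%E).
    by rewrite lee_wpmul2l// lee_fin invr_ge0 mulr_ge0// ltW.
  by rewrite -EFinM lee_fin (_ : (4 * v)^-1 * v = 1 / 4)//; field; rewrite gt_eqF.
have : (1%:E <= P [set w | r <= `|X w|]%R + P [set w | `|X w| <= r]%R)%E.
  rewrite -(probability_setT P); apply: (le_trans _ (measureU2 _ _ _)) => //.
  - rewrite le_measure ?inE//.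
      apply: measurableU; [exact: measurable_ge_norm|exact: measurable_le_norm].
    by move=> w _ /=; case: (leP r `|X w|) => [|/ltW]; [left|right].
  - exact: measurable_ge_norm.
  - exact: measurable_le_norm.
move=> /le_trans/(_ (leeD le14 (ball_normal_law _ (ltW r0)))).
rewrite -EFinD lee_fin -[s ^+ 2]real_normK ?num_real//.
set q := `|s| in s1 *; move=> h.
have : 3 / 4 <= r / q by lra.
rewrite ler_pdivlMr// => h2.
have : (3 / 4 * q) ^+ 2 <= r ^+ 2 by rewrite lerXn2r ?nnegrE// ?ltW// mulr_gt0.
by rewrite r2; nra.
Qed.

End normal.

Hypothesis gX : gaussian_law P X.

Lemma gaussian_tail (v l : R) : 0 < v -> 0 < l -> ('V_P[X] <= v%:E)%E ->
  (P [set w | l <= `|X w|]%R <= (2 * expR (- (l ^+ 2 / (32 * v))))%:E)%E.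
Proof.
move=> v0 l0 Vv.
have mA := measurable_norm_ge R l.
have -> : P [set w | l <= `|X w|] = pushforward P X [set x | l <= `|x|] by [].
case: gX => [[m law]|[m [s [s0 law]]]]; rewrite law//.
  rewrite (dirac_law_centered _ law) diracE memNset ?lee_fin ?mulr_ge0 ?expR_ge0//=.
  by rewrite normr0 leNgt l0.
rewrite (normal_law_centered _ _ s0 law).
apply: (le_trans (normal_prob_tail _ _ _ s0 (ltW l0))).
rewrite lee_fin ler_wpM2l// ler_expR lerN2 ler_wpM2l ?sqr_ge0//.
have s20 : 0 < s ^+ 2 by rewrite exprn_even_gt0.
have le8 := variance_normal_law_ge _ _ s0 law _ v0 Vv.
by rewrite lef_pV2 ?posrE; lra.
Qed.

Lemma gaussian_small_ball (v r : R) : 0 < v -> 0 <= r -> (v%:E <= 'V_P[X])%E ->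
  (P [set w | `|X w| <= r]%R <= (4 * r / Num.sqrt v)%:E)%E.
Proof.
move=> v0 r0 Vv.
case: gX => [[m law]|[m [s [s0 law]]]].
  have m0 := dirac_law_centered _ law.
  move: Vv; rewrite varianceE// EX0 expe2 mule0 sube0.
  have -> : (X : T -> R) ^+ 2 = (fun x => x ^+ 2) \o X by apply/funext.
  rewrite unlock.
  have := @ge0_integral_distribution _ _ _ _ _ P X (EFin \o (fun x : R => x ^+ 2)).
  move=> <-; last 2 first.
  - by apply/measurable_EFinP; exact: exprn_measurable.
  - by move=> x /=; rewrite lee_fin sqr_ge0.
  rewrite (@eq_measure_integral _ _ _ _ (dirac m)); last by move=> A mA _; exact: law.
  rewrite integral_dirac//=; last by apply/measurable_EFinP; exact: exprn_measurable.
  by rewrite m0 expr0n/= mule0 lee_fin leNgt v0.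
apply: (le_trans (ball_normal_law _ _ s0 law _ r0)).
have s1 : 0 < `|s| by rewrite normr_gt0.
rewrite lee_fin mulrC (mulrC 4) -mulrA [leRHS]mulrC ler_wpM2r//.
rewrite ler_pdivlMr ?sqrtr_gt0// mulrC ler_pdivrMr//.
have := le_trans Vv (variance_normal_law_le _ _ s0 law); rewrite lee_fin => h.
rewrite -[leRHS]ger0_norm ?mulr_ge0// -sqrtr_sqr ler_sqrt ?sqr_ge0//.
by rewrite exprMn real_normK ?num_real//; lra.
Qed.

End centered_gaussian.

(** * Dyadic chaining *)

Lemma powR2_lt1 (R : realType) (x : R) : x < 0 -> 2 `^ x < 1 :> R.
Proof.
move=> x0; have ln2 : 0 < ln 2 :> R by rewrite ln_gt0// ltr1n.
by rewrite /powR gt_eqF// -[ltRHS]expR0 ltr_expR pmulr_llt0.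
Qed.

Section geometric_steps.
Context {R : realType}.
Implicit Types (u : nat -> R) (C q : R).

Lemma geometric_steps_le u C q (m : nat) : 0 <= C -> 0 <= q < 1 ->
  (forall n, (m <= n)%N -> `|u n.+1 - u n| <= C * q ^+ n) ->
  forall n p, (m <= n)%N -> (n <= p)%N -> `|u p - u n| <= C / (1 - q) * q ^+ n.
Proof.
move=> C0 /andP[q0 q1] step n p mn /subnKC <-.
have q1' : 0 < 1 - q by rewrite subr_gt0.
suff h k : `|u (n + k)%N - u n| <= C / (1 - q) * (q ^+ n - q ^+ (n + k)).
  apply: (le_trans (h _)); rewrite ler_wpM2l ?divr_ge0 ?(ltW q1')//.
  by rewrite gerBl exprn_ge0.
elim: k => [|k ih]; first by rewrite addn0 !subrr normr0 mulr0.
rewrite -(subrKA (u (n + k)%N)) (le_trans (ler_normD _ _))//.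
rewrite addnS (le_trans (lerD (step _ (leq_trans mn (leq_addr _ _))) ih))//.
rewrite exprS le_eqVlt; apply/orP; left; apply/eqP; field.
by rewrite gt_eqF.
Qed.

Lemma geometric_steps_cvg u C q (m : nat) : 0 <= C -> 0 <= q < 1 ->
  (forall n, (m <= n)%N -> `|u n.+1 - u n| <= C * q ^+ n) ->
  cvgn u.
Proof.
move=> C0 q01 step; have [q0 q1] := andP q01.
have q1' : 0 < 1 - q by rewrite subr_gt0.
apply/cauchy_cvgP; apply: cauchy_exP => e e0.
have : (fun n => C / (1 - q) * q ^+ n) @ \oo --> (0 : R).
  rewrite -[X in _ --> X](mulr0 (C / (1 - q))).
  by apply: cvgMr; apply: cvg_expr; rewrite ger0_norm.
move=> /cvgr_lt/(_ e e0)[n0 _ hn0].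
exists (u (maxn m n0)); exists (maxn m n0) => // p /= np.
rewrite /ball/= distrC.
apply: le_lt_trans (hn0 (maxn m n0) (leq_maxr _ _)).
exact: (geometric_steps_le _ _ _ m C0 q01 step _ _ (leq_maxl _ _) np).
Qed.

Lemma geometric_steps_lim u C q (m : nat) (l : R) : 0 <= C -> 0 <= q < 1 ->
  (forall n, (m <= n)%N -> `|u n.+1 - u n| <= C * q ^+ n) ->
  u @ \oo --> l ->
  forall n, (m <= n)%N -> `|l - u n| <= C / (1 - q) * q ^+ n.
Proof.
move=> C0 q01 step ul n mn.
have : (fun p => `|u p - u n|) @ \oo --> `|l - u n|.
  by apply: cvg_norm; apply: cvgB => //; exact: cvg_cst.
move=> /cvgr_to_le; apply; exists n => // p /= np.
exact: (geometric_steps_le _ _ _ m).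
Qed.

End geometric_steps.

Definition dyadic_floor (R : realType) (n : nat) (t : R) : R :=
  (Num.floor (t * 2 ^+ n))%:~R / 2 ^+ n.

(* The range [|k| <= 4^n] covers [-2^n, 2^n], hence eventually every compact
   interval. *)
Definition dyadic_steps_le (R : realType) (f : R -> R) (C q : R) (n0 : nat) :=
  forall (n : nat) (k : int), (n0 <= n)%N -> `|k%:~R| <= 4 ^+ n :> R ->
    `|f ((k + 1)%:~R / 2 ^+ n) - f (k%:~R / 2 ^+ n)| <= C * q ^+ n.

Section dyadic_chaining.
Context {R : realType}.
Implicit Types (f g : R -> R) (C q t s : R).

Lemma norm_floor_le (t : R) (N n : nat) : `|t| <= N%:R -> (N < n)%N ->
  `|(Num.floor (t * 2 ^+ n))%:~R| <= n%:R * 2 ^+ n :> R.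
Proof.
move=> tN Nn.
have /andP[] := floor_itv (t * 2 ^+ n).
set k := Num.floor _; rewrite intrD => k1 k2.
have p1 : 1 <= 2 ^+ n :> R by rewrite exprn_ege1// ler1n.
have Nn' : N%:R + 1 <= n%:R :> R by rewrite natr1 ler_nat.
have h : (N%:R + 1) * 2 ^+ n <= n%:R * 2 ^+ n :> R by rewrite ler_wpM2r// (le_trans _ p1).
apply: le_trans h.
move: tN; rewrite !ler_norml => /andP[t1 t2].
by apply/andP; split; move: k1 k2; set K : R := k%:~R; nra.
Qed.

Lemma natr_expr2_le (n : nat) : n%:R * 2 ^+ n <= 4 ^+ n :> R.
Proof.
have -> : 4 ^+ n = 2 ^+ n * 2 ^+ n :> R by rewrite -exprMn; congr (_ ^+ _); ring.
by rewrite ler_wpM2r ?exprn_ge0// -natrX ler_nat ltnW// ltn_expl.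
Qed.

Lemma dyadic_floor_step f C q (n0 N n : nat) t :
  dyadic_steps_le R f C q n0 -> 0 <= C -> 0 <= q ->
  `|t| <= N%:R -> (maxn n0 N.+1 <= n)%N ->
  `|f (dyadic_floor R n.+1 t) - f (dyadic_floor R n t)| <= C * q ^+ n.+1.
Proof.
move=> fC C0 q0 tN; rewrite geq_max => /andP[n0n Nn].
rewrite /dyadic_floor; set k := Num.floor (t * 2 ^+ n).
have /andP[k1 k2] := floor_itv (t * 2 ^+ n); rewrite -/k in k1 k2.
have -> : k%:~R / 2 ^+ n = (2 * k)%:~R / 2 ^+ n.+1 :> R.
  by rewrite intrM exprS; field; rewrite expf_neq0.
set j := Num.floor _.
have jk1 : (2 * k <= j).
  by rewrite floor_ge_int intrM exprS mulrCA ler_wpM2l.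
have jk2 : (j < 2 * k + 2).
  rewrite floor_lt_int exprS mulrCA.
  by rewrite (_ : 2 * k + 2 = 2 * (k + 1)) ?intrM ?ltr_pM2l//; lia.
have [->|->] : j = 2 * k \/ j = 2 * k + 1 by lia.
  by rewrite subrr normr0 mulr_ge0// exprn_ge0.
apply: fC; first by rewrite ltnW.
have h := norm_floor_le t N n tN Nn; rewrite -/k in h.
rewrite intrM normrM ger0_norm// (le_trans _ (natr_expr2_le _))//.
rewrite exprS mulrCA ler_wpM2l//.
by rewrite (le_trans h)// ler_wpM2r ?exprn_ge0// ler_nat.
Qed.

Lemma dyadic_floor_cvg f C q n0 t : dyadic_steps_le R f C q n0 -> 0 <= C ->
  0 <= q < 1 -> cvgn (fun n => f (dyadic_floor R n t)).
Proof.
move=> fC C0 q01; have [q0 q1] := andP q01.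
pose N := (Num.truncn `|t|).+1.
have tN : `|t| <= N%:R by rewrite ltW// truncnS_gt.
apply: (geometric_steps_cvg _ C q (maxn n0 N.+1)) => // n nN.
apply: le_trans (dyadic_floor_step _ _ _ _ _ _ _ fC C0 q0 tN nN) _.
by rewrite exprS mulrCA ler_piMl ?mulr_ge0 ?exprn_ge0// ltW.
Qed.

Lemma dyadic_floor_dist f C q (n0 N n : nat) s t :
  dyadic_steps_le R f C q n0 -> 0 <= C -> 0 <= q ->
  `|s| <= N%:R -> (maxn n0 N.+1 <= n)%N -> s <= t -> t - s <= (2 ^+ n)^-1 ->
  `|f (dyadic_floor R n t) - f (dyadic_floor R n s)| <= C * q ^+ n.
Proof.
move=> fC C0 q0 sN; rewrite geq_max => /andP[n0n Nn] st ts.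
rewrite /dyadic_floor; set k := Num.floor (s * 2 ^+ n).
have /andP[k1 k2] := floor_itv (s * 2 ^+ n); rewrite -/k in k1 k2.
have p0 : 0 < 2 ^+ n :> R by rewrite exprn_gt0.
set j := Num.floor _.
have jk1 : (k <= j).
  by rewrite floor_ge_int (le_trans k1)// ler_wpM2r// ltW.
have jk2 : (j < k + 2).
  rewrite floor_lt_int (_ : k + 2 = k + 1 + 1); last by lia.
  rewrite intrD; move: ts; rewrite -(@ler_pM2r _ (2 ^+ n))// mulVf ?gt_eqF//.
  by rewrite mulrBl; lra.
have [->|->] : j = k \/ j = k + 1 by lia.
  by rewrite subrr normr0 mulr_ge0// exprn_ge0.
apply: fC => //.
have h := norm_floor_le s N n sN Nn; rewrite -/k in h.
exact: (le_trans h (natr_expr2_le _)).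
Qed.

Lemma int_bounded (F : int -> R) (L : nat) :
  exists M, 0 <= M /\ forall k : int, (`|k| <= L)%N -> `|F k| <= M.
Proof.
elim: L => [|L [M [M0 hM]]].
  exists `|F 0|; split=> // k; rewrite leqn0 absz_eq0 => /eqP ->; exact: lexx.
exists (M + `|F L.+1| + `|F (- L.+1%:Z)|); split; first by rewrite !addr_ge0.
move=> k; rewrite leq_eqVlt => /orP[/eqP kL|]; last first.
  by rewrite ltnS => /hM h; rewrite -addrA ler_wpDr// addr_ge0.
have [->|->] : k = L.+1%:Z \/ k = - L.+1%:Z by lia.
  by rewrite addrAC lerDr addr_ge0.
by rewrite lerDr addr_ge0.
Qed.

Lemma dyadic_chaining f g C gamma (n0 N : nat) : 0 < gamma -> 0 <= C ->
  dyadic_steps_le R f C (2 `^ (- gamma)) n0 ->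
  (forall t, f (dyadic_floor R n t) @[n --> \oo] --> g t) ->
  hoelder_on `[- N%:R, N%:R] gamma g.
Proof.
move=> gamma0 C0; set q := 2 `^ _ => fC fg.
have q0 : 0 < q by exact: powR_gt0.
have q1 : q < 1.
  by apply: powR2_lt1; rewrite oppr_lt0.
have qn n : q ^+ n = ((2 ^+ n)^-1) `^ gamma.
  rewrite -powR_mulrn ?(ltW q0)// /q -powRrM -(powR_invn _ (ler0n _ 2)) -powRrM.
  by congr (_ `^ _); ring.
have qn0 n : 0 <= q ^+ n by rewrite exprn_ge0// ltW.
pose m0 := maxn n0 N.+1.
pose K := C / (1 - q).
have K0 : 0 <= K by rewrite divr_ge0// subr_ge0 ltW.
have step t : `|t| <= N%:R -> forall n, (m0 <= n)%N ->
    `|f (dyadic_floor R n.+1 t) - f (dyadic_floor R n t)| <= C * q ^+ n.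
  move=> tN n nN.
  apply: le_trans (dyadic_floor_step _ _ _ _ _ _ _ fC C0 (ltW q0) tN nN) _.
  by rewrite exprS mulrCA ler_piMl ?mulr_ge0 ?exprn_ge0 ?(ltW q0)// ltW.
have approx t : `|t| <= N%:R -> forall n, (m0 <= n)%N ->
    `|g t - f (dyadic_floor R n t)| <= K * q ^+ n.
  move=> tN; apply: (geometric_steps_lim _ C q m0) => //.
    by rewrite (ltW q0).
  exact: step.
have [M [M0 hM]] := int_bounded (fun k => f (k%:~R / 2 ^+ m0)) (4 ^ m0)%N.
have gM t : `|t| <= N%:R -> `|g t| <= K * q ^+ m0 + M.
  move=> tN; rewrite -[g t](subrK (f (dyadic_floor R m0 t))).
  rewrite (le_trans (ler_normD _ _))// lerD ?approx//.
  apply: hM.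
  have := norm_floor_le t N m0 tN (leq_maxr _ _).
  move=> /le_trans/(_ (natr_expr2_le _)).
  by rewrite -intr_norm -natr_absz -(natrX _ 4) ler_nat.
pose C1 := (2 * K + C) * q^-1.
pose C2 := 2 * (K * q ^+ m0 + M) / q ^+ m0.
have C10 : 0 <= C1 by rewrite /C1 mulr_ge0 ?invr_ge0 ?(ltW q0)// addr_ge0// mulr_ge0.
have C20 : 0 <= C2.
  by rewrite /C2 divr_ge0// mulr_ge0// addr_ge0// mulr_ge0.
exists (C1 + C2).
have main s t : `|s| <= N%:R -> `|t| <= N%:R -> s < t ->
    `|g t - g s| <= (C1 + C2) * (t - s) `^ gamma.
  move=> sN tN st.
  have h0 : 0 < t - s by rewrite subr_gt0.
  have [large|small] := leP (2 ^+ m0)^-1 (t - s).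
    apply: (@le_trans _ _ (C2 * (t - s) `^ gamma)); last first.
      by rewrite ler_wpM2r ?powR_ge0// lerDr.
    rewrite (le_trans (ler_normB _ _))// (le_trans (lerD (gM _ tN) (gM _ sN)))//.
    rewrite -mulr2n -mulr_natl /C2 -mulrA ler_peMr//.
      by rewrite mulr_ge0// addr_ge0// mulr_ge0.
    rewrite mulrC ler_pdivlMr ?exprn_gt0// mul1r qn.
    by rewrite ge0_ler_powR ?nnegrE ?invr_ge0 ?exprn_ge0 ?(ltW h0) ?(ltW gamma0).
  have exn : exists n, (t - s) * 2 ^+ n <= 1.
    by exists m0; rewrite -ler_pdivlMr ?exprn_gt0// mul1r ltW.
  have bdn n : (t - s) * 2 ^+ n <= 1 -> (n <= Num.truncn (t - s)^-1)%N.
    rewrite -ler_pdivlMl// mulr1 => h; rewrite truncn_ge_nat ?invr_ge0 ?(ltW h0)//.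
    by apply: le_trans h; rewrite -natrX ler_nat ltnW// ltn_expl.
  pose n := ex_maxn exn bdn.
  have [n1 nmax] : (t - s) * 2 ^+ n <= 1 /\ 1 < (t - s) * 2 ^+ n.+1.
    rewrite /n; case: ex_maxnP => i i1 imax; split=> //.
    by rewrite ltNge; apply/negP => /imax; rewrite ltnn.
  have m0n : (m0 <= n)%N.
    rewrite /n; case: ex_maxnP => i i1; apply.
    by rewrite -ler_pdivlMr ?exprn_gt0// mul1r ltW.
  have p0 : 0 < 2 ^+ n :> R by rewrite exprn_gt0.
  have tsn : t - s <= (2 ^+ n)^-1 by rewrite -[leRHS]mul1r ler_pdivlMr.
  have h1 := dyadic_floor_dist _ _ _ _ _ n s t fC C0 (ltW q0) sN m0n (ltW st) tsn.
  have h2 := approx t tN n m0n.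
  have h3 := approx s sN n m0n.
  have h4 : q ^+ n <= q^-1 * (t - s) `^ gamma.
    rewrite -ler_pdivrMl ?invr_gt0// invrK -exprS qn.
    rewrite ge0_ler_powR ?nnegrE ?invr_ge0 ?exprn_ge0 ?(ltW h0) ?(ltW gamma0)//.
    by rewrite -[leLHS]mul1r ler_pdivrMr ?exprn_gt0// ltW.
  apply: (@le_trans _ _ (C1 * (t - s) `^ gamma)); last first.
    by rewrite ler_wpM2r ?powR_ge0// lerDl.
  apply: (@le_trans _ _ ((2 * K + C) * q ^+ n)); last first.
    by rewrite /C1 -mulrA ler_wpM2l// addr_ge0// mulr_ge0.
  move: h1 h2 h3; set x := f _; set y := f _ => h1 h2 h3.
  have -> : g t - g s = (g t - x) + (x - y) - (g s - y) by ring.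
  rewrite (le_trans (ler_normB _ _))// (le_trans (lerD (ler_normD _ _) (lexx _)))//.
  by rewrite (le_trans (lerD (lerD h2 h1) h3))//; lra.
have normN t : `[- N%:R, N%:R]%classic t -> `|t| <= N%:R.
  by rewrite /= in_itv/= ler_norml.
move=> s t /normN sN /normN tN.
have [st|ts|->] := ltgtP s t.
- by rewrite distrC (distrC s) (gtr0_norm (_ : 0 < t - s)) ?subr_gt0// main.
- by rewrite (gtr0_norm (_ : 0 < s - t)) ?subr_gt0// main.
- by rewrite !subrr !normr0 mulr_ge0 ?addr_ge0 ?powR_ge0.
Qed.

End dyadic_chaining.

(** * Increments of fractional Brownian motion *)

Section fBm.
Context {R : realType} {d : measure_display} {T : measurableType d}.
Context (P : probability T R) (H : R) (B : R -> {RV P >-> R}).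
Hypothesis H0 : 0 < H.
Hypothesis fB : is_fBm H B.

Let cov t s : covariance P (B t) (B s) =
  (2^-1 * (`|s| `^ (2 * H) + `|t| `^ (2 * H) - `|t - s| `^ (2 * H)))%:E.
Proof. by case: fB => _ _ ->. Qed.

Lemma fBm_expectation t : ('E_P[B t] = 0)%E.
Proof. by case: fB. Qed.

Lemma fBm_Lfun2 t : (B t : T -> R) \in Lfun P 2%:E.
Proof.
have := cov t t; rewrite unlock fBm_expectation/= unlock => h.
rewrite inE; apply/andP; split; rewrite inE//=.
rewrite /finite_norm unlock /= poweR_lty//.
apply: (le_lt_trans _ (ltry (2^-1 * (`|t| `^ (2 * H) + `|t| `^ (2 * H)
  - `|t - t| `^ (2 * H))))); rewrite -h.
rewrite le_eqVlt; apply/orP; left; apply/eqP/eq_integral => w _ /=.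
rewrite (_ : (_ * _) w = (B t w - 0) * (B t w - 0))//.
by rewrite subr0 powR_mulrn// -expr2 real_normK ?num_real.
Qed.

Let covE t s : covariance P (B t : T -> R) (B s : T -> R) =
  (2^-1 * (`|s| `^ (2 * H) + `|t| `^ (2 * H) - `|t - s| `^ (2 * H)))%:E.
Proof. exact: cov. Qed.

Lemma fBm_incr_Lfun2 s t : (B t \- B s : T -> R) \in Lfun P 2%:E.
Proof. by rewrite rpredB ?lee1n//= => _; exact: fBm_Lfun2. Qed.

Let Lfun21 (X : T -> R) : X \in Lfun P 2%:E -> X \in Lfun P 1.
Proof. exact: (Lfun_subset12 (fin_num_measure P _ measurableT)). Qed.

Lemma fBm_incr_expectation s t : ('E_P[(B t \- B s)%R] = 0)%E.
Proof.
by rewrite expectationB ?fBm_expectation ?sube0//; apply: Lfun21; exact: fBm_Lfun2.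
Qed.

Lemma fBm_incr_covariance s t s' t' :
  covariance P (B t \- B s) (B t' \- B s') =
  (2^-1 * (`|t - s'| `^ (2 * H) + `|s - t'| `^ (2 * H)
           - `|t - t'| `^ (2 * H) - `|s - s'| `^ (2 * H)))%:E.
Proof.
rewrite covarianceBl ?covarianceBr ?fBm_Lfun2 ?fBm_incr_Lfun2//.
by rewrite !covE -!EFinB; congr EFin; field.
Qed.

Lemma fBm_incr_variance s t : ('V_P[(B t \- B s)%R] = (`|t - s| `^ (2 * H))%:E)%E.
Proof.
rewrite /variance fBm_incr_covariance !subrr normr0 powR0 ?mulf_neq0 ?gt_eqF//.
by rewrite distrC; congr EFin; field.
Qed.

Lemma fBm_incr_gaussian s t : gaussian_law P (B t \- B s).
Proof.
case: fB => + _ _ => /(_ 2 (fun i => if i == ord0 then t else s)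
  (fun i => if i == ord0 then 1 else -1)).
congr gaussian_law; apply/funext => w.
by rewrite !big_ord_recl big_ord0 /= mul1r mulN1r addr0.
Qed.

Variables a b : R.

Let gincrE s t : (fun w => gfBm a b B t w - gfBm a b B s w) =
  (a \o* (B t \- B s)) \+ (b \o* (B (- t) \- B (- s))).
Proof. by apply/funext => w; rewrite /gfBm /=; ring. Qed.

Lemma gfBm_incr_Lfun2 s t :
  (fun w => gfBm a b B t w - gfBm a b B s w) \in Lfun P 2%:E.
Proof.
rewrite gincrE rpredD ?lee1n//= => _; rewrite Lfun_scale ?ler1n//;
  exact: fBm_incr_Lfun2.
Qed.

Lemma gfBm_incr_expectation s t :
  ('E_P[(fun w => gfBm a b B t w - gfBm a b B s w)%R] = 0)%E.
Proof.
rewrite gincrE expectationD; last 2 first.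
- by rewrite Lfun_scale//; apply: Lfun21; exact: fBm_incr_Lfun2.
- by rewrite Lfun_scale//; apply: Lfun21; exact: fBm_incr_Lfun2.
rewrite !expectationZl ?fBm_incr_expectation ?mule0 ?adde0//;
  by apply: Lfun21; exact: fBm_incr_Lfun2.
Qed.

Lemma gfBm_incr_variance s t :
  ('V_P[(fun w => gfBm a b B t w - gfBm a b B s w)%R] =
   ((a ^+ 2 + b ^+ 2) * `|t - s| `^ (2 * H) +
    a * b * (2 * `|t + s| `^ (2 * H) - `|2 * t| `^ (2 * H) - `|2 * s| `^ (2 * H)))%:E)%E.
Proof.
rewrite gincrE.
have L2 := fBm_incr_Lfun2 s t; have L2' := fBm_incr_Lfun2 (- s) (- t).
have L1 := Lfun21 _ L2; have L1' := Lfun21 _ L2'.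
rewrite varianceD ?Lfun_scale ?ler1n//.
rewrite !varianceZ// !fBm_incr_variance covarianceZl ?Lfun_scale//; last first.
  by rewrite Lfun2_mul_Lfun1 ?Lfun_scale ?ler1n.
rewrite covarianceZr//; last by rewrite Lfun2_mul_Lfun1.
rewrite fBm_incr_covariance -!EFinM -!EFinD.
rewrite (_ : - t - - s = - (t - s)); last by ring.
rewrite (_ : t - - s = t + s); last by ring.
rewrite (_ : s - - t = t + s); last by ring.
rewrite (_ : t - - t = 2 * t); last by ring.
rewrite (_ : s - - s = 2 * s); last by ring.
rewrite normrN; congr EFin.
move: (_ `^ _) (_ `^ _) (_ `^ _) (_ `^ _) => x y z u.
by field.
Qed.

Lemma gfBm_incr_gaussian s t :
  gaussian_law P (fun w => gfBm a b B t w - gfBm a b B s w).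
Proof.
case: fB => + _ _ => /(_ 4 (fun i => nth 0 [:: t; s; - t; - s] i)
  (fun i => nth 0 [:: a; - a; b; - b] i)).
congr gaussian_law; apply/funext => w.
by rewrite !big_ord_recl big_ord0 /= /gfBm; ring.
Qed.

End fBm.

Lemma is_derive1_powR_shift (R : realType) (p h x : R) : 0 < x + h ->
  is_derive x 1 (fun y => (y + h) `^ p) (p * (x + h) `^ (p - 1)).
Proof.
move=> xh.
have d1 : is_derive x 1 (fun y : R => y + h) 1.
  by apply: is_derive_eq; rewrite addr0.
have d2 : is_derive (x + h) 1 (fun y : R => y `^ p) (p * (x + h) `^ (p - 1)).
  exact: is_derive1_powR.
have := @is_derive1_comp _ (fun y : R => y `^ p) (fun y : R => y + h) x _ _ d2 d1.
by rewrite mulr1.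
Qed.

Lemma powR_second_difference (R : realType) (p x h : R) : p <= 2 -> 0 < x ->
  0 < h ->
  `|(x + 2 * h) `^ p - 2 * (x + h) `^ p + x `^ p|
    <= `|p * (p - 1)| * x `^ (p - 2) * h ^+ 2.
Proof.
move=> p2 x0 h0.
pose g y := (y + h) `^ p - (y + 0) `^ p.
have dg (y : R) : 0 < y ->
    is_derive y 1 g (p * (y + h) `^ (p - 1) - p * (y + 0) `^ (p - 1)).
  move=> y0; apply: is_deriveB; apply: is_derive1_powR_shift; rewrite ?addr0//.
  exact: addr_gt0.
have contd (f df : R -> R) (a b : R) : 0 < a ->
    (forall y : R, 0 < y -> is_derive y 1 f (df y)) ->
    {within `[a, b], continuous f}.
  move=> a0 dff; apply: derivable_within_continuous => y.
  by rewrite in_itv/= => /andP[ay _]; apply: ex_derive; apply: dff; exact: lt_le_trans ay.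
have [|y||c] := @MVT R g (fun y => p * (y + h) `^ (p - 1) - p * (y + 0) `^ (p - 1))
   x (x + h).
- by rewrite ltrDl.
- by rewrite in_itv/= => /andP[xy _]; apply: dg; exact: lt_trans xy.
- exact: contd dg.
rewrite in_itv/= => /andP[xc _].
have c0 : 0 < c by exact: lt_trans xc.
have d1 (y : R) : 0 < y ->
    is_derive y 1 (fun y : R => y `^ (p - 1)) ((p - 1) * y `^ (p - 1 - 1)).
  by move=> y0; exact: is_derive1_powR.
have [|y||e] := @MVT R (fun y : R => y `^ (p - 1))
    (fun y => (p - 1) * y `^ (p - 1 - 1)) c (c + h).
- by rewrite ltrDl.
- by rewrite in_itv/= => /andP[cy _]; apply: d1; exact: lt_trans cy.
- exact: contd d1.
rewrite in_itv/= => /andP[ce _] e1.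
rewrite /g !addr0 [c + h - c]addrAC subrr add0r in e1 *.
rewrite -mulrBr e1 [x + h - x]addrAC subrr add0r.
have -> : x + h + h = x + 2 * h by ring.
have -> : p - 1 - 1 = p - 2 by ring.
move=> e2.
have -> : (x + 2 * h) `^ p - 2 * (x + h) `^ p + x `^ p =
   (x + 2 * h) `^ p - (x + h) `^ p - ((x + h) `^ p - x `^ p).
  by move: (_ `^ _) (_ `^ _) (_ `^ _) => u v w; ring.
rewrite e2 (_ : p * _ * h = p * (p - 1) * e `^ (p - 2) * h ^+ 2); last first.
  by move: (_ `^ _) => u; ring.
have e0 : 0 < e by exact: lt_trans ce.
rewrite normrM [`|h ^+ 2|]ger0_norm ?sqr_ge0// ler_wpM2r ?sqr_ge0//.
rewrite normrM [`|e `^ _|]ger0_norm ?powR_ge0// ler_wpM2l//.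
have -> : p - 2 = - (2 - p) by ring.
rewrite !powRN lef_pV2 ?posrE ?powR_gt0//.
by rewrite ge0_ler_powR ?subr_ge0 ?nnegrE ?(ltW x0) ?(ltW e0)// ltW// (lt_trans xc).
Qed.

(* For s > 0 the cross term is a second difference of a function smooth near 2s,
   hence negligible against h^(2H); for s = 0 it is proportional to h^(2H), with a
   factor in ]-2, 2[. *)
Lemma gfBm_variance_lower_bound (R : realType) (H a b s : R) :
  0 < H < 1 -> (a, b) != (0, 0) -> 0 <= s ->
  exists2 c : R, 0 < c & \forall h \near 0^'+,
    c * h `^ (2 * H) <=
    (a ^+ 2 + b ^+ 2) * `|s + h - s| `^ (2 * H) +
    a * b * (2 * `|s + h + s| `^ (2 * H) - `|2 * (s + h)| `^ (2 * H) - `|2 * s| `^ (2 * H)).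
Proof.
move=> /andP[H0 H1] ab0 s0.
have ab : 0 < a ^+ 2 + b ^+ 2.
  rewrite lt_neqAle addr_ge0 ?sqr_ge0// andbT eq_sym paddr_eq0 ?sqr_ge0// !sqrf_eq0.
  by apply: contra ab0 => /andP[/eqP -> /eqP ->].
have p0 : 0 < 2 * H by rewrite mulr_gt0.
have p2 : 2 * H < 2 by lra.
move: p0 p2; set p := 2 * H => p0 p2.
move: s0; rewrite le_eqVlt => /predU1P[<-|s0].
  pose k := 2 - 2 `^ p.
  have k2 : -2 < k.
    have : 2 `^ p < 2 `^ 2%:R :> R.
      by rewrite /powR gt_eqF// ltr_expR ltr_pM2r// ln_gt0// ltr1n.
    by rewrite powR_mulrn// expr2 /k; lra.
  have k1 : k < 1.
    rewrite /k; have : 2 `^ 0 < 2 `^ p :> R.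
      by rewrite /powR gt_eqF// ltr_expR ltr_pM2r// ln_gt0// ltr1n.
    by rewrite powRr0; lra.
  exists (a ^+ 2 + b ^+ 2 + a * b * k).
    have -> : a ^+ 2 + b ^+ 2 + a * b * k =
      (1 - k / 2) / 2 * (a - b) ^+ 2 + (1 + k / 2) / 2 * (a + b) ^+ 2 by field.
    have [ab1|ab1] := eqVneq (a - b) 0.
      rewrite ltr_wpDl//; first by rewrite mulr_ge0 ?sqr_ge0//; lra.
      rewrite mulr_gt0//; first by lra.
      rewrite exprn_even_gt0//=; apply: contra ab0 => /eqP h.
      by apply/eqP; congr (_, _); lra.
    rewrite ltr_wpDr//; first by rewrite mulr_ge0 ?sqr_ge0//; lra.
    by rewrite mulr_gt0// ?exprn_even_gt0//; lra.
  near=> h.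
  have h0 : 0 < h by near: h; exact: nbhs_right_gt.
  rewrite !add0r !addr0 subr0 mulr0 normr0 powR0 ?gt_eqF// subr0 normrM !gtr0_norm//.
  rewrite powRM ?(ltW h0)// /k le_eqVlt; apply/orP; left; apply/eqP.
  by move: (_ `^ _) (_ `^ _) => u v; ring.
pose K := `|a * b| * (`|p * (p - 1)| * (2 * s) `^ (p - 2)).
have K0 : 0 <= K by rewrite mulr_ge0// mulr_ge0// powR_ge0.
pose c := (a ^+ 2 + b ^+ 2) / 2.
have c0 : 0 < c by rewrite divr_gt0.
exists c => //; near=> h.
have h0 : 0 < h by near: h; exact: nbhs_right_gt.
have small : K * h `^ (2 - p) <= c.
  near: h.
  have : (fun h => K * h `^ (2 - p)) @ 0^'+ --> (0 : R).
    rewrite -[X in _ --> X](mulr0 K); apply: cvgMr; apply: powR_cvg0.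
    by rewrite subr_gt0.
  by move=> /cvgr_le; apply.
have -> : s + h - s = h by ring.
have -> : s + h + s = 2 * s + h by ring.
have -> : 2 * (s + h) = 2 * s + 2 * h by ring.
have x0 : 0 < 2 * s by rewrite mulr_gt0.
rewrite !gtr0_norm ?addr_gt0//; last by rewrite mulr_gt0.
have sd := powR_second_difference _ p (2 * s) h (ltW p2) x0 h0.
have hp : h `^ p * h `^ (2 - p) = h ^+ 2.
  rewrite -powRD; first by rewrite addrC subrK powR_mulrn// ltW.
  by apply/implyP => _; rewrite gt_eqF.
have : `|a * b * (2 * (2 * s + h) `^ p - (2 * s + 2 * h) `^ p - (2 * s) `^ p)|
    <= K * h ^+ 2.
  rewrite normrM /K -mulrA ler_wpM2l// -normrN.
  apply: le_trans sd; rewrite le_eqVlt; apply/orP; left; apply/eqP; congr `|_|.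
  by move: (_ `^ _) (_ `^ _) (_ `^ _) => u v w; ring.
rewrite ler_norml => /andP[+ _].
have : K * h ^+ 2 <= c * h `^ p.
  by rewrite -hp mulrCA [leRHS]mulrC ler_wpM2l ?powR_ge0.
have := powR_ge0 h p.
rewrite /c; set y := a * b * _; set u := h `^ p; set z := K * _; nra.
Unshelve. all: by end_near. Qed.

(** * The continuous version *)

Lemma ae_eventually_notin d (T : measurableType d) (R : realType)
    (P : probability T R) (F : nat -> set T) :
  (forall n, measurable (F n)) -> (forall n, P (F n) <= (2^-1 ^+ n)%:E)%E ->
  {ae P, forall w, exists n0, forall n, (n0 <= n)%N -> ~ F n w}.
Proof.
move=> mF PF.
have sumF : (\sum_(n <oo) P (F n) < +oo)%E.
  apply: (@le_lt_trans _ _ (\sum_(n <oo) (2 / (2 ^ n.+1)%:R)%:E)%E); last first.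
    by rewrite (le_lt_trans (epsilon_trick0 xpredT _))// ltry.
  apply: lee_nneseries => // n _; rewrite (le_trans (PF n))// lee_fin.
  by rewrite natrX exprS invfM mulrA divff// mul1r exprVn.
exists (lim_sup_set F); split.
- by apply: bigcap_measurable => // k _; apply: bigcup_measurable.
- exact: lim_sup_set_cvg0.
- move=> w /= h n _; apply: contrapT => hn; apply: h; exists n => k nk Fk.
  by apply: hn; exists k.
Qed.

Lemma expR_geometric_le (R : realType) (n : nat) :
  2 * expR (- ((16 * n.+1%:R) ^+ 2 / 32)) <= 2 / 9 * 9^-1 ^+ n :> R.
Proof.
apply: (@le_trans _ _ (2 * expR (- 8) ^+ n.+1)).
  rewrite ler_wpM2l// -expRM_natr ler_expR.
  have : 1 <= n.+1%:R :> R by rewrite ler1n.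
  by set x : R := n.+1%:R; nra.
rewrite -mulrA -exprS ler_wpM2l// lerXn2r ?nnegrE ?expR_ge0//.
by rewrite expRN lef_pV2 ?posrE ?expR_gt0// (le_trans _ (expR_ge1Dx _))//; lra.
Qed.

(* (n + 1) r^n is bounded for r < 1, so a logarithmic factor costs only an
   arbitrarily small loss in the Hoelder exponent. *)
Lemma linear_geometric_bounded (R : realType) (r : R) : 0 < r -> r < 1 ->
  exists2 C : R, 0 <= C & forall n : nat, n.+1%:R * r ^+ n <= C.
Proof.
move=> r0 r1.
have L0 : 0 < - ln r by rewrite oppr_gt0 ln_lt0// r0.
exists (expR (- ln r) / - ln r); first by rewrite divr_ge0 ?expR_ge0 ?ltW.
move=> n; rewrite ler_pdivlMr//.
rewrite -[r in r ^+ n]lnK ?posrE// -expRM_natr.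
rewrite mulrAC -ler_pdivlMr ?expR_gt0// -expRN -expRD.
have -> : - ln r - ln r * n%:R = n.+1%:R * - ln r by rewrite -natr1; ring.
by rewrite (le_trans _ (expR_ge1Dx _))// lerDr.
Qed.

Lemma expr_powR (R : realType) (n : nat) (x : R) :
  (2^-1 ^+ n) `^ x = (2 `^ (- x)) ^+ n :> R.
Proof.
rewrite -powR_mulrn ?powR_ge0// -powRrM exprVn -powR_invn// -powRrM.
by congr (_ `^ _); ring.
Qed.

Section fBm_version.
Context {R : realType} {d : measure_display} {T : measurableType d}.
Context (P : probability T R) (H : R) (B : R -> {RV P >-> R}).
Hypothesis H01 : 0 < H < 1.
Hypothesis fB : is_fBm H B.

Let H0 : 0 < H. Proof. by case/andP: H01. Qed.

Let threshold (n : nat) : R := 16 * n.+1%:R * (2^-1 ^+ n) `^ H.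

Let h0 n : 0 < 2^-1 ^+ n :> R.
Proof. by rewrite exprn_gt0. Qed.

Let large_incr (n : nat) (s t : R) : set T :=
  [set w | threshold n <= `|(B t \- B s) w|].

Let measurable_large_incr n s t : measurable (large_incr n s t).
Proof. exact: measurable_ge_norm. Qed.

Let large_incr_le n s t : `|t - s| <= 2^-1 ^+ n ->
  (P (large_incr n s t) <= (2 / 9 * 9^-1 ^+ n)%:E)%E.
Proof.
move=> ts.
have v0 : 0 < (2^-1 ^+ n) `^ (2 * H) :> R by rewrite powR_gt0.
have t0 : 0 < threshold n by rewrite mulr_gt0 ?powR_gt0// mulr_gt0.
have Vle : ('V_P[(B t \- B s)%R] <= ((2^-1 ^+ n) `^ (2 * H))%:E)%E.
  rewrite (fBm_incr_variance _ _ _ H0 fB) lee_fin.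
  by rewrite ge0_ler_powR ?nnegrE ?mulr_ge0 ?(ltW H0) ?(ltW (h0 n)).
have := gaussian_tail P (B t \- B s) (fBm_incr_Lfun2 P H B fB s t)
  (fBm_incr_expectation P H B fB s t) (fBm_incr_gaussian P H B fB s t) _ _ v0 t0 Vle.
move=> /le_trans; apply; rewrite lee_fin; apply: le_trans (expR_geometric_le R n).
rewrite ler_wpM2l// ler_expR lerN2 le_eqVlt; apply/orP; left; apply/eqP.
rewrite /threshold (mulrC 2 H) powRrM powR_mulrn ?powR_ge0//.
have : (2^-1 ^+ n) `^ H != 0 :> R by rewrite gt_eqF ?powR_gt0.
by move: (_ `^ H) => y y0; field.
Qed.

Lemma fBm_dyadic_incr_small : {ae P, forall w, exists n0, forall n (k : int),
  (n0 <= n)%N -> `|k%:~R| <= 4 ^+ n :> R ->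
  `|B ((k + 1)%:~R / 2 ^+ n) w - B (k%:~R / 2 ^+ n) w| <= threshold n}.
Proof.
pose E n (i : nat) := large_incr n ((i%:Z - (4 ^ n)%:Z)%:~R / 2 ^+ n)
                                  ((i%:Z - (4 ^ n)%:Z + 1)%:~R / 2 ^+ n).
pose G n := \big[setU/set0]_(i < (2 * 4 ^ n).+1) E n i.
have PG n : (P (G n) <= (2^-1 ^+ n)%:E)%E.
  apply: (@le_trans _ _ (\sum_(i < (2 * 4 ^ n).+1) P (E n i))%E).
    by apply: Boole_inequality => i _; exact: measurable_large_incr.
  apply: (@le_trans _ _ (\sum_(i < (2 * 4 ^ n).+1) (2 / 9 * 9^-1 ^+ n)%:E)%E).
    apply: lee_sum => i _; apply: large_incr_le.
    rewrite -mulrBl -intrB [X in X%:~R](_ : _ = 1); last by ring.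
    by rewrite mul1r ger0_norm ?invr_ge0 ?exprn_ge0// exprVn.
  rewrite sumEFin lee_fin sumr_const card_ord -[leLHS]mulr_natl -(natr1 (2 * 4 ^ n)%N).
  rewrite natrM natrX.
  have : 1 <= 4 ^+ n :> R by rewrite exprn_ege1// ler1n.
  have -> : 2^-1 ^+ n = (4 ^+ n * 9^-1 ^+ n) * (9 / 8) ^+ n :> R.
    by rewrite -!exprMn; congr (_ ^+ _); field.
  have : 1 <= (9 / 8) ^+ n :> R by rewrite exprn_ege1//; lra.
  have : 0 <= 9^-1 ^+ n :> R by rewrite exprn_ge0.
  set x : R := 4 ^+ n; set y : R := 9^-1 ^+ n; set z : R := _ ^+ n => y0 z1 x1.
  have xy : y <= x * y by rewrite ler_peMl.
  have : x * y <= x * y * z by rewrite ler_peMr// mulr_ge0// (le_trans _ x1).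
  by lra.
have := ae_eventually_notin _ _ _ P G _ PG.
have mG n : measurable (G n).
  by apply: bigsetU_measurable => i _; exact: measurable_large_incr.
move=> /(_ mG); apply: filterS => w [n0 hn0]; exists n0 => n k nn kn.
rewrite leNgt; apply/negP => big; apply: (hn0 n nn).
have k4 : (`|k| <= 4 ^ n)%N.
  by move: kn; rewrite -intr_norm -natr_absz -(natrX _ 4) ler_nat.
have [i ki] : exists i : nat, k = i%:Z - (4 ^ n)%:Z.
  by exists (absz (k + (4 ^ n)%:Z)); move: k4; set q := (4 ^ n)%N; lia.
have i4 : (i < (2 * 4 ^ n).+1)%N.
  by move: k4; rewrite ki; set q := (4 ^ n)%N; lia.
rewrite /G -bigcup_mkord; exists i => //.
by rewrite /E -ki; exact: ltW.
Qed.

Lemma threshold_le (gamma : R) : gamma < H ->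
  exists2 C : R, 0 <= C & forall n, threshold n <= C * (2 `^ (- gamma)) ^+ n.
Proof.
move=> gH.
have r0 : 0 < 2 `^ (gamma - H) :> R by rewrite powR_gt0.
have r1 : 2 `^ (gamma - H) < 1 :> R.
  by apply: powR2_lt1; rewrite subr_lt0.
have [C C0 hC] := linear_geometric_bounded R _ r0 r1.
exists (16 * C) => [|n]; first by rewrite mulr_ge0.
rewrite /threshold -!mulrA ler_wpM2l// expr_powR.
have -> : - H = (gamma - H) + (- gamma) by ring.
rewrite powRD; last by apply/implyP => _; rewrite gt_eqF.
by rewrite exprMn mulrA ler_wpM2r ?exprn_ge0 ?powR_ge0.
Qed.

Lemma fBm_dyadic_floor_cvg t :
  {ae P, forall w, B (dyadic_floor R n t) w @[n --> \oo] --> B t w}.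
Proof.
pose F n := large_incr n (dyadic_floor R n t) t.
have PF n : (P (F n) <= (2^-1 ^+ n)%:E)%E.
  apply: (le_trans (large_incr_le _ _ _ _)).
    have p0 : 0 < 2 ^+ n :> R by rewrite exprn_gt0.
    have /andP[] := floor_itv (t * 2 ^+ n).
    rewrite intrD => k1 k2.
    rewrite /dyadic_floor ger0_norm ?subr_ge0 ?ler_pdivrMr// exprVn.
    rewrite -(@ler_pM2r _ (2 ^+ n))// mulrBl mulfVK ?gt_eqF// mulVf ?gt_eqF//.
    by rewrite lerBlDl ltW.
  rewrite lee_fin (@le_trans _ _ (9^-1 ^+ n))//.
    by rewrite ler_piMl ?exprn_ge0//; lra.
  by rewrite lerXn2r ?nnegrE//; lra.
have mF n : measurable (F n) by exact: measurable_large_incr.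
apply: filterS (ae_eventually_notin _ _ _ P F mF PF) => w [n0 hn0].
have [|C C0 hC] := threshold_le (H / 2).
  by have := H0; lra.
have q0 : 0 < 2 `^ (- (H / 2)) :> R by rewrite powR_gt0.
have q1 : 2 `^ (- (H / 2)) < 1 :> R.
  by apply: powR2_lt1; have := H0; lra.
apply/cvgrPdist_le => e e0.
have : (fun n => C * (2 `^ (- (H / 2))) ^+ n) @ \oo --> (0 : R).
  rewrite -[X in _ --> X](mulr0 C).
  by apply: cvgMr; apply: cvg_expr; rewrite ger0_norm// ltW.
move=> /cvgr_le/(_ e e0)[n1 _ hn1].
exists (maxn n0 n1) => // n /=; rewrite geq_max => /andP[nn0 nn1].
apply: le_trans (hn1 n nn1); apply: le_trans (hC n).
by rewrite leNgt; apply/negP => /ltW; exact: hn0.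
Qed.

Lemma fBm_version : exists Z : R -> {RV P >-> R},
  (forall t, {ae P, forall w, Z t w = B t w}) /\
  {ae P, forall w, forall gamma (N : nat), 0 < gamma -> gamma < H ->
     hoelder_on `[- N%:R, N%:R] gamma (fun t => Z t w)}.
Proof.
have [A [mA A0 sA]] := fBm_dyadic_incr_small.
have goodA w : ~ A w -> exists n0, forall n (k : int),
  (n0 <= n)%N -> `|k%:~R| <= 4 ^+ n :> R ->
  `|B ((k + 1)%:~R / 2 ^+ n) w - B (k%:~R / 2 ^+ n) w| <= threshold n.
  by move=> Aw; apply: contrapT => h; apply: Aw; apply: sA.
have steps w gamma : ~ A w -> gamma < H -> exists2 C : R, 0 <= C &
    exists n0, dyadic_steps_le R (B ^~ w) C (2 `^ (- gamma)) n0.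
  move=> Aw gH; have [n0 hn0] := goodA w Aw; have [C C0 hC] := threshold_le _ gH.
  by exists C => //; exists n0 => n k nn kn; exact: le_trans (hn0 n k nn kn) (hC n).
pose u t n w := B (dyadic_floor R n t) w * \1_(~` A) w.
have ucvg t w : cvgn (u t ^~ w).
  have [Aw|Aw] := pselect (A w).
    rewrite (_ : u t ^~ w = cst 0); first exact: is_cvg_cst.
    by apply/funext => n; rewrite /u indicE memNset ?mulr0//=; exact.
  rewrite (_ : u t ^~ w = (fun n => B (dyadic_floor R n t) w)); last first.
    by apply/funext => n; rewrite /u indicE mem_set ?mulr1.
  have [C C0 [n0 st]] := steps w (H / 2) Aw ltac:(by have := H0; lra).
  apply: (dyadic_floor_cvg _ _ _ _ _ st C0).
  by rewrite powR_ge0/=; apply: powR2_lt1; have := H0; lra.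
pose z t w := limn (u t ^~ w).
have mz t : measurable_fun setT (z t).
  apply: (@measurable_fun_cvg _ _ _ setT (u t)) => [n|w _]; last exact: ucvg.
  apply: measurable_funM => //; apply: measurable_indic; exact: measurableC.
pose mixz t := isMeasurableFun.Build _ _ _ _ _ (mz t).
pose Z t : {RV P >-> R} := HB.pack (z t) (mixz t).
have Zlim t w : ~ A w -> B (dyadic_floor R n t) w @[n --> \oo] --> Z t w.
  move=> Aw.
  rewrite (_ : (fun n => B (dyadic_floor R n t) w) = u t ^~ w); first exact: ucvg.
  by apply/funext => n; rewrite /u indicE mem_set ?mulr1.
have aeA : {ae P, forall w, ~ A w}.
  by exists A; split=> // w /= /contrapT.
exists Z; split=> [t|].
  apply: filterS2 aeA (fBm_dyadic_floor_cvg t) => w Aw Bt.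
  exact: cvg_unique (Zlim t w Aw) Bt.
apply: filterS aeA => w Aw gamma N g0 gH.
have [C C0 [n0 st]] := steps w gamma Aw gH.
by apply: (dyadic_chaining _ _ _ _ _ N g0 C0 st) => t; exact: Zlim.
Qed.

End fBm_version.

(** * Sample paths *)

Section gfBm_paths.
Context {R : realType} {d : measure_display} {T : measurableType d}.
Context (P : probability T R) (H a b : R) (B : R -> {RV P >-> R}).
Hypothesis H01 : 0 < H < 1.
Hypothesis ab0 : (a, b) != (0, 0).
Hypothesis fB : is_fBm H B.

Lemma measurable_gfBm t : measurable_fun setT (gfBm a b B t).
Proof. by apply: measurable_funD; exact: measurable_funM. Qed.

(* The increments are Gaussian with standard deviation at least of order h^H, so
   the probability that they are at most M h is O(h^(1 - H)). *)
Lemma gfBm_incr_small_prob (t0 M e : R) : 0 <= t0 -> 0 <= M -> 0 < e ->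
  \forall h \near 0^'+,
    (P [set w | `|gfBm a b B (t0 + h) w - gfBm a b B t0 w| <= M * h]%R <= e%:E)%E.
Proof.
move=> t00 M0 e0; have [H0 H1] := andP H01.
have [c c0 Vc] := gfBm_variance_lower_bound R H a b t0 H01 ab0 t00.
have small : \forall h \near 0^'+, 4 * M / Num.sqrt c * h `^ (1 - H) <= e.
  have : (fun h => 4 * M / Num.sqrt c * h `^ (1 - H)) @ 0^'+ --> (0 : R).
    rewrite -[X in _ --> X](mulr0 (4 * M / Num.sqrt c)).
    by apply: cvgMr; apply: powR_cvg0; rewrite subr_gt0.
  by move=> /cvgr_le; apply.
near=> h.
have h0 : 0 < h by near: h; exact: nbhs_right_gt.
have hV : c * h `^ (2 * H) <=
    (a ^+ 2 + b ^+ 2) * `|t0 + h - t0| `^ (2 * H) +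
    a * b * (2 * `|t0 + h + t0| `^ (2 * H) - `|2 * (t0 + h)| `^ (2 * H)
             - `|2 * t0| `^ (2 * H)) by near: h.
have he : 4 * M / Num.sqrt c * h `^ (1 - H) <= e by near: h.
pose D w := gfBm a b B (t0 + h) w - gfBm a b B t0 w.
have mD : measurable_fun setT D by apply: measurable_funB; exact: measurable_gfBm.
pose mixD := isMeasurableFun.Build _ _ _ _ _ mD.
pose X : {RV P >-> R} := HB.pack D mixD.
have v0 : 0 < c * h `^ (2 * H) by rewrite mulr_gt0// powR_gt0.
have Mh : 0 <= M * h by rewrite mulr_ge0// ltW.
have VX : ((c * h `^ (2 * H))%:E <= 'V_P[X])%E.
  by rewrite (gfBm_incr_variance P H B H0 fB a b) lee_fin.
have := gaussian_small_ball P X (gfBm_incr_Lfun2 P H B fB a b t0 (t0 + h))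
  (gfBm_incr_expectation P H B fB a b t0 (t0 + h))
  (gfBm_incr_gaussian P H B fB a b t0 (t0 + h)) _ _ v0 Mh VX.
move=> /le_trans; apply; rewrite lee_fin; apply: le_trans he.
rewrite le_eqVlt; apply/orP; left; apply/eqP.
rewrite (mulrC 2 H) powRrM powR_mulrn ?powR_ge0// sqrtrM ?(ltW c0)//.
rewrite sqrtr_sqr ger0_norm ?powR_ge0// powRB; last first.
  by apply/implyP => _; rewrite gt_eqF.
rewrite powRr1 ?(ltW h0)//.
have : Num.sqrt c != 0 by rewrite gt_eqF ?sqrtr_gt0.
have : h `^ H != 0 by rewrite gt_eqF ?powR_gt0.
by move: (_ `^ H) (Num.sqrt c) => x y x0 y0; field; apply/andP; split.
Unshelve. all: by end_near. Qed.

Lemma gfBm_incr_quotient_unbounded (t0 : R) : 0 <= t0 ->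
  {ae P, forall w, forall M n0 : nat, exists2 n : nat, (n0 <= n)%N &
    M%:R * n.+1%:R^-1 <
      `|gfBm a b B (t0 + n.+1%:R^-1) w - gfBm a b B t0 w|}.
Proof.
move=> t00; apply: ae_foralln => M; apply: ae_foralln => n0.
pose F n := [set w | `|gfBm a b B (t0 + n.+1%:R^-1) w - gfBm a b B t0 w|
                       <= M%:R * n.+1%:R^-1].
have mF n : measurable (F n).
  have mD : measurable_fun setT
      (fun w => gfBm a b B (t0 + n.+1%:R^-1) w - gfBm a b B t0 w).
    by apply: measurable_funB; exact: measurable_gfBm.
  pose mixD := isMeasurableFun.Build _ _ _ _ _ mD.
  pose X : {mfun T >-> R} := HB.pack
    (fun w => gfBm a b B (t0 + n.+1%:R^-1) w - gfBm a b B t0 w) mixD.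
  exact: (measurable_le_norm _ T R X).
have mcap : measurable (\bigcap_(n in [set n | (n0 <= n)%N]) F n).
  by apply: bigcap_measurable => [|k _//]; exists n0 => /=.
exists (\bigcap_(n in [set n | (n0 <= n)%N]) F n); split=> //.
- apply/eqP; rewrite -measure_le0; apply/lee_addgt0Pr => e e0; rewrite add0e.
  have [r /= r0 hr] := gfBm_incr_small_prob t0 M%:R e t00 (ler0n _ _) e0.
  have [n1 _ hn1] := near_infty_natSinv_lt (PosNum r0).
  pose n := maxn n0 n1.
  apply: (@le_trans _ _ (P (F n))).
    rewrite le_measure ?inE//.
    by apply: bigcap_inf => /=; exact: leq_maxl.
  apply: hr => //=; rewrite ?invr_gt0//.
  by rewrite sub0r normrN gtr0_norm ?invr_gt0//; apply: hn1; exact: leq_maxr.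
- move=> w /= h n nn; rewrite /F /= leNgt; apply/negP => lt; apply: h.
  by exists n.
Qed.

End gfBm_paths.

Lemma sup_diff_quotient_cvgy (R : realType) (f : R -> R) (t0 : R) : 0 <= t0 ->
  (forall M n0 : nat, exists2 n : nat, (n0 <= n)%N &
    M%:R * n.+1%:R^-1 < `|f (t0 + n.+1%:R^-1) - f t0|) ->
  sup_diff_quotient f t0 e @[e --> 0^'+] --> +oo%E.
Proof.
move=> t00 hf.
suff h : forall e, 0 < e -> sup_diff_quotient f t0 e = +oo%E.
  apply: cvg_near_cst; near=> e; apply: h; near: e; exact: nbhs_right_gt.
move=> e e0; apply/eqyP => A A0.
have [n1 _ hn1] := near_infty_natSinv_lt (PosNum e0).
have [n nn lt] := hf (Num.truncn A).+1 n1.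
have n0 : 0 < n.+1%:R^-1 :> R by rewrite invr_gt0.
apply: (@le_trans _ _ (`|(f (t0 + n.+1%:R^-1) - f t0) / (t0 + n.+1%:R^-1 - t0)|)%:E).
  rewrite lee_fin [t0 + _ - t0]addrAC subrr add0r normrM.
  rewrite [`|n.+1%:R^-1^-1|]gtr0_norm ?invr_gt0//.
  rewrite ler_pdivlMr// ltW//; apply: lt_trans lt.
  by rewrite ltr_pM2r// truncnS_gt.
apply: ereal_sup_ubound; exists (t0 + n.+1%:R^-1) => //; split.
- have := hn1 n nn; rewrite /= => ne.
  by rewrite !lerD2l (ltW ne) andbT (le_trans _ (ltW n0))// oppr_le0 ltW.
- by rewrite addr_ge0// ltW.
- by rewrite -subr_eq0 addrAC subrr add0r gt_eqF.
Unshelve. all: by end_near. Qed.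

Lemma hoelder_onS (R : realType) (D E : set R) (g : R) (f : R -> R) :
  D `<=` E -> hoelder_on E g f -> hoelder_on D g f.
Proof. by move=> DE [C h]; exists C => s t /DE Es /DE Et; exact: h. Qed.

Lemma hoelder_on_reflect_comb (R : realType) (N : nat) (g a b : R) (f : R -> R) :
  hoelder_on `[- N%:R, N%:R] g f ->
  hoelder_on `[- N%:R, N%:R] g (fun t => a * f t + b * f (- t)).
Proof.
move=> [C h]; exists (`|a| * C + `|b| * C) => s t sN tN.
have oppN u : `[- N%:R, N%:R]%classic u -> `[- N%:R, N%:R]%classic (- u : R).
  by rewrite /= !in_itv/= lerN2 lerNl andbC.
have h1 := h s t sN tN; have h2 := h (- s) (- t) (oppN _ sN) (oppN _ tN).
have e : - s - - t = - (s - t) by ring.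
rewrite e normrN in h2.
have -> : a * f s + b * f (- s) - (a * f t + b * f (- t)) =
  a * (f s - f t) + b * (f (- s) - f (- t)) by ring.
rewrite (le_trans (ler_normD _ _))// !normrM mulrDl -!mulrA.
by rewrite lerD// ler_wpM2l.
Qed.

Theorem lemma5 (R : realType) (d : measure_display) (T : measurableType d)
    (P : probability T R) (H a b : R) (B : R -> {RV P >-> R}) :
  0 < H < 1 -> (a, b) != (0, 0) -> is_fBm H B ->
  exists Z : R -> {RV P >-> R},
    [/\ is_version Z (gfBm a b B),
        {ae P, forall w : T, forall c d g : R, 0 <= c -> c <= d ->
          0 < g -> g < H -> hoelder_on `[c, d] g (fun t => Z t w)} &
        forall t0 : R, 0 <= t0 ->
          {ae P, forall w : T,
            sup_diff_quotient (fun t => Z t w) t0 e @[e --> 0^'+] --> +oo%E}].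
Proof.
move=> H01 ab0 fB.
have [Y [YB Yh]] := fBm_version P H B H01 fB.
have mZ t : measurable_fun setT (gfBm a b Y t) by exact: measurable_gfBm.
pose mixZ t := isMeasurableFun.Build _ _ _ _ _ (mZ t).
pose Z t : {RV P >-> R} := HB.pack (gfBm a b Y t) (mixZ t).
have ZX t : {ae P, forall w, Z t w = gfBm a b B t w}.
  by apply: filterS2 (YB t) (YB (- t)) => w /= e1 e2; rewrite /= /gfBm e1 e2.
exists Z; split=> [t _||t0 t00].
- set E := [set w | _].
  have mE : measurable E.
    have mD : measurable_fun setT (fun w => Z t w - gfBm a b B t w).
      by apply: measurable_funB => //; exact: measurable_gfBm.
    have -> : E = (fun w => Z t w - gfBm a b B t w) @^-1` [set 0].
      by apply/seteqP; split=> w; [move=> Ew; apply/eqP; rewrite subr_eq0; apply/eqP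
                                 |move/subr0_eq].
    by rewrite -[X in measurable X]setTI; apply: mD.
  rewrite -[E]setCK probability_setC; last exact: measurableC.
  by rewrite (measure_negligible (measurableC mE) (ZX t)) sube0.
- apply: filterS Yh => w Yw c e g c0 ce g0 gH.
  pose N := (Num.truncn e).+1.
  apply: (hoelder_onS _ _ `[- N%:R, N%:R]).
    move=> t /=; rewrite !in_itv/= => /andP[ct te].
    rewrite (le_trans _ (le_trans c0 ct)) ?oppr_le0//=.
    by rewrite (le_trans te)// ltW// truncnS_gt.
  by apply: hoelder_on_reflect_comb; exact: Yw.
- have Zn : {ae P, forall w, forall n : nat,
      Z (t0 + n.+1%:R^-1) w = gfBm a b B (t0 + n.+1%:R^-1) w}.
    by apply: ae_foralln => n; exact: ZX.
  have := gfBm_incr_quotient_unbounded P H a b B H01 ab0 fB t0 t00.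
  apply: filterS3 Zn (ZX t0) => w en e0 unb.
  apply: sup_diff_quotient_cvgy => // M n0; have [n nn lt] := unb M n0.
  by exists n => //; rewrite en e0.
Qed.
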